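(* Let $c_1,c_2\in\mathbb{C}$ and let $r_1,r_2\in\mathbb{C}$ be the roots of $x^2+c_1x+c_2=(x-r_1)(x-r_2)=0$. Suppose that $r_1\neq 0$, $r_2\neq 0$, $r_1\neq r_2$, and that the line $L_1\subset\mathbb{C}$ through $r_1$ and $r_2$ does not pass through the origin. Put $p_1=-c_1/2$, $\theta^*=\tfrac12\arg\!\left(\tfrac{c_1^2}{4}-c_2\right)$ and $v_{\theta^*}=e^{i\theta^*}$. Then: (1) $L_1=\{p_1+t\,v_{\theta^*} : t\in\mathbb{R}\}$. (2) The set $C=\{c_2/(p_1+t\,v_{\theta^*}) : t\in\mathbb{R}\}$ is a circle passing through the origin, with the origin itself removed. The center of this circle is $$c=\frac{-y_1(x_2^2+y_2^2)+y_2(x_1^2+y_1^2)}{2x_1y_2-2x_2y_1}+i\,\frac{x_1(x_2^2+y_2^2)-x_2(x_1^2+y_1^2)}{2x_1y_2-2x_2y_1},$$ where $w_1=c_2/p_1=x_1+iy_1$ and $w_2=c_2/(p_1+v_{\theta^*})=x_2+iy_2$ with $x_1,y_1,x_2,y_2\in\mathbb{R}$, and its radius is $|c|$. (3) The roots are exactly the intersections of $L_1$ and $C$, i.e. $L_1\cap C=\{r_1,r_2\}$.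
   Context: Lines and circles are subsets of the complex plane $\mathbb{C}$ identified with $\mathbb{R}^2$; a line is a full infinite straight line. For a nonzero complex number $w$, $\arg(w)$ denotes an argument of $w$ (a real number $\phi$ with $w=|w|e^{i\phi}$); any choice of argument may be used. *)

(* Defs.v *)
From Stdlib Require Import Reals.
From Coquelicot Require Import Coquelicot.
Open Scope C_scope.

Definition cis (phi : R) : C := (cos phi, sin phi).

(* Multivalued: [is_arg w phi] says that [phi] is one of the arguments of
   [w].  It is only meaningful for [w <> 0], since every real number is an
   argument of 0 in this sense. *)
Definition is_arg (w : C) (phi : R) : Prop := w = Cmod w * cis phi.

(* A line only when [a <> b]. *)
Definition line_through (a b : C) : C -> Prop :=
  fun z => exists t : R, z = a + t * (b - a).

(* A genuine circle only when [0 < r]. *)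
Definition circle (c : C) (r : R) : C -> Prop :=
  fun z => Cmod (z - c) = r.

(* Main.v *)
Require Import Defs.
From Stdlib Require Import Reals Lra Classical.
From Coquelicot Require Import Coquelicot.
Open Scope C_scope.

(** Since [c1^2/4 - c2 = ((r1 - r2)/2)^2], its square roots [+-s v] are real
    multiples of [v], and [r1], [r2] are [p1 + s v], [p1 - s v].  A point [z] lies
    on the line [p + R v] iff the imaginary part of [(z - p) conj v] vanishes;
    for [c2/z] in place of [z], multiplying by [|z|^2] turns this into the
    equation of a circle through 0, whose center is recovered from the two
    points [w1], [w2] by Cramer's rule.  Finally [(p1 + t v)(p1 + t' v) = c2 = p1^2 - s^2 v^2]
    forces [t' = -t] and [t^2 = s^2] because [p1] and [v] are linearly
    independent over the reals. *)

(** The imaginary part of [p * Cconj v]; up to sign, the determinant of [p] and [v] as vectors of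
    the real plane. *)
Definition cross (p v : C) : R := (Im p * Re v - Re p * Im v)%R.

Definition normsq (z : C) : R := (Re z ^ 2 + Im z ^ 2)%R.

Lemma normsq_pos (z : C) : z <> 0 -> (0 < normsq z)%R.
Proof.
  destruct z as [x y]; unfold normsq; simpl; intros H.
  assert (H' : (x <> 0 \/ y <> 0)%R).
  { destruct (Req_dec x 0) as [-> | Hx]; [right | now left].
    intros ->; now apply H. }
  destruct H'; nra.
Qed.

Lemma cross_neq0_r (p v : C) : cross p v <> 0%R -> v <> 0.
Proof. intros H ->; apply H; unfold cross; simpl; ring. Qed.

Lemma cross_eq0 (p v : C) :
  v <> 0 -> cross p v = 0%R -> exists t : R, p = t * v.
Proof.
  intros Hv; pose proof (normsq_pos v Hv) as Hn.
  destruct p as [a b], v as [x y]; unfold cross, normsq in *; simpl in *.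
  intros H.
  (* The real part of [p / v], whose imaginary part is a multiple of the vanishing [cross]. *)
  exists ((a * x + b * y) / (x ^ 2 + y ^ 2))%R.
  apply injective_projections; simpl.
  - transitivity ((a * x + b * y) / (x ^ 2 + y ^ 2) * x - y * (b * x - a * y) / (x ^ 2 + y ^ 2))%R.
    + field; simpl; lra.
    + rewrite H; field; simpl; lra.
  - transitivity ((a * x + b * y) / (x ^ 2 + y ^ 2) * y + x * (b * x - a * y) / (x ^ 2 + y ^ 2))%R.
    + field; simpl; lra.
    + rewrite H; field; simpl; lra.
Qed.

(** Eliminating [b] from the real and imaginary parts leaves [a * cross p v = 0]; eliminating [a]
    leaves [b * cross p v = 0]. *)
Lemma cross_independent (p v : C) (a b : R) :
  cross p v <> 0%R -> a * p + b * v = 0 -> a = 0%R /\ b = 0%R.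
Proof.
  destruct p as [px py], v as [vx vy]; unfold cross; simpl; intros H E.
  injection E; simpl; intros E2 E1.
  split; apply (Rmult_eq_reg_r (py * vx - px * vy)); trivial.
  - transitivity (vx * (a * py + b * vy) - vy * (a * px + b * vx))%R; [ring |].
    replace (a * py + b * vy)%R with 0%R by lra.
    replace (a * px + b * vx)%R with 0%R by lra; ring.
  - transitivity (py * (a * px + b * vx) - px * (a * py + b * vy))%R; [ring |].
    replace (a * py + b * vy)%R with 0%R by lra.
    replace (a * px + b * vx)%R with 0%R by lra; ring.
Qed.

Lemma line_avoids_0 (p v : C) (t : R) : cross p v <> 0%R -> p + t * v <> 0.
Proof.
  intros H E.
  destruct (cross_independent p v 1 t H) as [H1 _]; [rewrite <- E; ring | lra].
Qed.

Lemma cross_neq0 (p v : C) :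
  v <> 0 -> (forall t : R, p + t * v <> 0) -> cross p v <> 0%R.
Proof.
  intros Hv H E.
  destruct (cross_eq0 p v Hv E) as [t ->].
  apply (H (- t)%R); rewrite RtoC_opp; ring.
Qed.

(** Multiplying both arguments of [cross] by [z] scales it by [normsq z], and adding [t * v] to [p]
    does not change [cross p v]. So [a = z * (p + t * v)] gives the equation; conversely, the
    equation makes [a / z - p] a real multiple of [v]. *)
Lemma inverted_line (a p v z : C) :
  a <> 0 -> cross p v <> 0%R ->
  ((exists t : R, z = a / (p + t * v)) <->
   z <> 0 /\ (normsq z * cross p v)%R = cross a (z * v)).
Proof.
  intros Ha Hk; split.
  - intros [t Hz].
    pose proof (line_avoids_0 p v t Hk) as Hq.
    assert (E : a = z * (p + t * v)) by (rewrite Hz; field; exact Hq).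
    split.
    + intros ->; apply Ha; rewrite E; ring.
    + rewrite E; destruct z, p, v; unfold cross, normsq; simpl; ring.
  - intros [Hz E].
    pose proof (normsq_pos z Hz) as Hn.
    assert (Ea : a = z * (a / z)) by (field; exact Hz).
    assert (H0 : cross (a / z - p) v = 0%R).
    { apply (Rmult_eq_reg_l (normsq z)); [| lra].
      rewrite Ea in E.
      revert E; generalize (a / z); intros y E.
      transitivity (cross (z * y) (z * v) - normsq z * cross p v)%R;
        [| rewrite E; ring].
      destruct z, p, v, y; unfold cross, normsq; simpl; ring. }
    destruct (cross_eq0 _ _ (cross_neq0_r _ _ Hk) H0) as [t Ht].
    exists t; rewrite <- Ht.
    replace (p + (a / z - p)) with (a / z) by ring.
    field; now split.
Qed.

(** Squaring [|z - c| = |c|] cancels [|c|^2]; what remains can be compared with the equation of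
    [inverted_line]. *)
Lemma circle_through_0 (c z : C) :
  circle c (Cmod c) z <-> normsq z = (2 * (Re c * Re z + Im c * Im z))%R.
Proof.
  unfold circle, Cmod, normsq; destruct c as [a b], z as [x y]; cbn -[pow].
  split.
  - intros H; apply sqrt_inj in H; [lra | |]; apply Rplus_le_le_0_compat; apply pow2_ge_0.
  - intros H; f_equal; lra.
Qed.

(** For [a <> 0], inversion keeps two points independent over the reals; this makes the denominator
    [d] of the center nonzero. *)
Lemma cross_inverse_points (a p q : C) :
  p <> 0 -> q <> 0 ->
  (cross (a / q) (a / p) * (normsq p * normsq q))%R = (normsq a * cross p q)%R.
Proof.
  intros Hp Hq.
  assert (Ep : a = a / p * p) by (field; exact Hp).
  assert (Eq : a = a / q * q) by (field; exact Hq).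
  revert Ep Eq; generalize (a / p) (a / q); intros w1 w2 E1 E2.
  (* [cross _ 1] is the imaginary part; in this product [w1 * p] and [w2 * q] both equal [a]. *)
  transitivity (cross (Cconj (w1 * p) * (w2 * q) * (p * Cconj q)) 1).
  - destruct w1, w2, p, q; unfold cross, normsq; simpl; ring.
  - rewrite <- E1, <- E2.
    destruct a, p, q; unfold cross, normsq; simpl; ring.
Qed.

(* With [k = cross p v] and [q = a conj v], the equation of [inverted_line]
   reads [k |z|^2 = Im q * Re z - Re q * Im z]. *)
Lemma circumcenter (x1 y1 x2 y2 k qx qy : R) :
  let d := (2 * x1 * y2 - 2 * x2 * y1)%R in
  d <> 0%R -> k <> 0%R ->
  ((x1 ^ 2 + y1 ^ 2) * k = qy * x1 - qx * y1)%R ->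
  ((x2 ^ 2 + y2 ^ 2) * k = qy * x2 - qx * y2)%R ->
  ((- y1 * (x2 ^ 2 + y2 ^ 2) + y2 * (x1 ^ 2 + y1 ^ 2)) / d = qy / (2 * k) /\
   (x1 * (x2 ^ 2 + y2 ^ 2) - x2 * (x1 ^ 2 + y1 ^ 2)) / d = - qx / (2 * k))%R.
Proof.
  intros d Hd Hk E1 E2.
  assert (F1 : (x1 ^ 2 + y1 ^ 2 = (qy * x1 - qx * y1) / k)%R)
    by (rewrite <- E1; field; exact Hk).
  assert (F2 : (x2 ^ 2 + y2 ^ 2 = (qy * x2 - qx * y2) / k)%R)
    by (rewrite <- E2; field; exact Hk).
  rewrite F1, F2; unfold d in *; split; field; split; auto.
Qed.

Lemma cis_neq0 (t : R) : cis t <> 0.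
Proof.
  intros E; injection E; intros E2 E1.
  pose proof (sin2_cos2 t) as H; rewrite E1, E2 in H; unfold Rsqr in H; lra.
Qed.

Lemma cis_half_sqr (phi : R) : cis (1 / 2 * phi) ^ 2 = cis phi.
Proof.
  replace (cis phi) with (cis (2 * (1 / 2 * phi))) by (f_equal; field).
  unfold cis; rewrite cos_2a, sin_2a.
  apply injective_projections; simpl; ring.
Qed.

(** [a] and [Cmod a * cis (phi / 2)] have the same square, so they agree up to a sign, which [s]
    absorbs. Hence any choice of argument works. *)
Lemma is_arg_sqrt (a : C) (phi : R) :
  is_arg (a ^ 2) phi -> exists s : R, a = s * cis (1 / 2 * phi).
Proof.
  unfold is_arg; rewrite <- cis_half_sqr.
  set (v := cis _); intros H.
  assert (Hs : RtoC (Cmod (a ^ 2)) = RtoC (Cmod a) ^ 2).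
  { rewrite <- RtoC_pow; f_equal; simpl; rewrite !Cmult_1_r, Cmod_mult; ring. }
  rewrite Hs in H.
  assert (E : (a - Cmod a * v) * (a + Cmod a * v) = 0).
  { transitivity (a ^ 2 - Cmod a ^ 2 * v ^ 2); [ring | rewrite H at 1; ring]. }
  destruct (Ceq_dec (a - Cmod a * v) 0) as [E1 | N1].
  - exists (Cmod a).
    transitivity (a - Cmod a * v + Cmod a * v); [ring | rewrite E1; ring].
  - destruct (Ceq_dec (a + Cmod a * v) 0) as [E2 | N2].
    + exists (- Cmod a)%R; rewrite RtoC_opp.
      transitivity (a + Cmod a * v - Cmod a * v); [ring | rewrite E2; ring].
    + now destruct (Cmult_neq_0 _ _ N1 N2).
Qed.

(** Evaluation at 0 gives the product of the roots, evaluation at 1 then their sum. *)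
Lemma vieta_quadratic (c1 c2 r1 r2 : C) :
  (forall x : C, x ^ 2 + c1 * x + c2 = (x - r1) * (x - r2)) ->
  c1 = - (r1 + r2) /\ c2 = r1 * r2.
Proof.
  intros H.
  assert (H2 : c2 = r1 * r2).
  { transitivity (0 ^ 2 + c1 * 0 + c2); [ring | rewrite H; ring]. }
  split; [| exact H2].
  transitivity (1 ^ 2 + c1 * 1 + c2 - 1 - c2); [ring | rewrite H, H2; ring].
Qed.

Lemma line_through_symmetric (p v : C) (s : R) :
  s <> 0%R ->
  forall z : C,
    line_through (p + s * v) (p - s * v) z <-> exists t : R, z = p + t * v.
Proof.
  intros Hs z; split; intros [t ->].
  - exists (s * (1 - 2 * t))%R.
    rewrite RtoC_mult, RtoC_minus, RtoC_mult; ring.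
  (* The inverse of the parameter change [t => s * (1 - 2 * t)] used above. *)
  - exists ((1 - t / s) / 2)%R.
    rewrite RtoC_div, RtoC_minus, RtoC_div by (trivial; lra).
    field; intros E; apply Hs; now injection E.
Qed.

Lemma line_meets_inverse (p v z : C) (s : R) :
  cross p v <> 0%R ->
  let c2 := (p + s * v) * (p - s * v) in
  (exists t : R, z = p + t * v) /\ (exists t : R, z = c2 / (p + t * v)) <->
  z = p + s * v \/ z = p - s * v.
Proof.
  intros Hk c2.
  pose proof (fun t => line_avoids_0 p v t Hk) as H0.
  assert (Hm : p - s * v = p + (- s)%R * v) by (rewrite RtoC_opp; ring).
  split.
  - intros [[t Ht] [t' Ht']].
    assert (E : (p + t * v) * (p + t' * v) = c2).
    { rewrite <- Ht, Ht'; field; apply H0. }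
    (* The left side times [v] is [(p + t * v) * (p + t' * v) - c2], and [v <> 0]. *)
    assert (E' : (t + t')%R * p + (t * t' + s * s)%R * v = 0).
    { apply NNPP; intros N; apply (Cmult_neq_0 _ _ N (cross_neq0_r _ _ Hk)).
      rewrite !RtoC_plus, !RtoC_mult.
      transitivity ((p + t * v) * (p + t' * v) - c2); [unfold c2; ring | rewrite E; ring]. }
    destruct (cross_independent _ _ _ _ Hk E') as [A B].
    assert (F : ((t - s) * (t + s) = 0)%R) by nra.
    apply Rmult_integral in F; rewrite Ht.
    destruct F as [F | F]; [left | right].
    + now replace t with s by lra.
    + rewrite Hm; now replace t with (- s)%R by lra.
  - intros [-> | ->]; split.
    + now exists s.
    (* Dividing [c2] by one of its two factors gives the other, so the parameter changes sign. *)
    + exists (- s)%R; rewrite <- Hm; unfold c2; field.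
      rewrite Hm; apply H0.
    + now exists (- s)%R.
    + exists s; unfold c2; field; apply H0.
Qed.

Theorem mainTheorem1
  (c1 c2 r1 r2 : C)
  (Hroots : forall x : C, x ^ 2 + c1 * x + c2 = (x - r1) * (x - r2))
  (Hr1 : r1 <> 0) (Hr2 : r2 <> 0) (Hr12 : r1 <> r2)
  (HL0 : ~ line_through r1 r2 0)
  (phi : R) (Hphi : is_arg (c1 ^ 2 / 4 - c2) phi) :
  let L1 : C -> Prop := line_through r1 r2 in
  let p1 : C := - c1 / 2 in
  let theta : R := (1 / 2 * phi)%R in
  let v : C := cis theta in
  let CC : C -> Prop := fun z => exists t : R, z = c2 / (p1 + t * v) in
  let w1 : C := c2 / p1 in
  let w2 : C := c2 / (p1 + v) in
  let x1 : R := Re w1 in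
  let y1 : R := Im w1 in
  let x2 : R := Re w2 in
  let y2 : R := Im w2 in
  let d : R := (2 * x1 * y2 - 2 * x2 * y1)%R in
  let c : C :=
    RtoC ((- y1 * (x2 ^ 2 + y2 ^ 2) + y2 * (x1 ^ 2 + y1 ^ 2)) / d)%R
    + Ci * RtoC ((x1 * (x2 ^ 2 + y2 ^ 2) - x2 * (x1 ^ 2 + y1 ^ 2)) / d)%R in
  (forall z : C, L1 z <-> exists t : R, z = p1 + t * v)
  /\ ((forall t : R, p1 + t * v <> 0)
      /\ d <> 0%R
      /\ (0 < Cmod c)%R
      /\ circle c (Cmod c) 0
      /\ (forall z : C, CC z <-> circle c (Cmod c) z /\ z <> 0))
  /\ (forall z : C, L1 z /\ CC z <-> z = r1 \/ z = r2).
Proof.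
  intros L1 p1 theta v CC w1 w2 x1 y1 x2 y2 d c.
  destruct (vieta_quadratic _ _ _ _ Hroots) as [Ec1 Ec2].
  assert (Hc2 : c2 <> 0) by (rewrite Ec2; now apply Cmult_neq_0).
  assert (two : RtoC 2 <> 0) by (intros E; injection E; lra).
  assert (Hdisc : c1 ^ 2 / 4 - c2 = ((r1 - r2) / 2) ^ 2).
  { rewrite Ec1, Ec2.
    replace (RtoC 4) with (RtoC 2 * RtoC 2)
      by (rewrite <- RtoC_mult; f_equal; ring).
    field; exact two. }
  rewrite Hdisc in Hphi.
  destruct (is_arg_sqrt _ _ Hphi) as [s Hs].
  change (cis (1 / 2 * phi)) with v in Hs.
  assert (Er1 : r1 = p1 + s * v)
    by (rewrite <- Hs; unfold p1; rewrite Ec1; field; exact two).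
  assert (Er2 : r2 = p1 - s * v)
    by (rewrite <- Hs; unfold p1; rewrite Ec1; field; exact two).
  assert (Hs0 : s <> 0%R).
  { intros E; apply Hr12; rewrite Er1, Er2, E; ring. }
  assert (HL : forall z : C, L1 z <-> exists t : R, z = p1 + t * v).
  { unfold L1; rewrite Er1, Er2; now apply line_through_symmetric. }
  assert (Hline0 : forall t : R, p1 + t * v <> 0).
  { intros t E; apply HL0, HL; now exists t. }
  assert (Hk : cross p1 v <> 0%R)
    by (apply cross_neq0; [apply cis_neq0 | exact Hline0]).
  assert (Hp : p1 <> 0).
  { intros E; apply (Hline0 0%R); rewrite E; ring. }
  assert (Hpv : p1 + v <> 0).
  { intros E; apply (Hline0 1%R); rewrite <- E; ring. }
  assert (HCC : forall z, CC z <->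
            z <> 0 /\ (normsq z * cross p1 v)%R = cross c2 (z * v))
    by (intros z; now apply inverted_line).
  (* [w1] and [w2] are the points of [CC] with parameters 0 and 1. *)
  assert (Hw1 : CC w1).
  { exists 0%R; unfold w1; f_equal; ring. }
  assert (Hw2 : CC w2).
  { exists 1%R; unfold w2; f_equal; ring. }
  assert (Hd : d <> 0%R).
  { intros E.
    pose proof (cross_inverse_points c2 p1 (p1 + v) Hp Hpv) as H.
    fold w1 w2 in H.
    assert (E1 : cross w2 w1 = 0%R).
    { unfold d, x1, x2, y1, y2 in E; unfold cross; lra. }
    assert (E2 : cross p1 (p1 + v) = cross p1 v).
    { destruct p1, v; unfold cross; simpl; ring. }
    rewrite E1, E2, Rmult_0_l in H; symmetry in H.
    pose proof (normsq_pos _ Hc2).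
    apply Rmult_integral in H; destruct H; [lra | now apply Hk]. }
  assert (Hexp : forall z, cross c2 (z * v) =
      (Im (c2 * Cconj v) * Re z - Re (c2 * Cconj v) * Im z)%R).
  { intros z; destruct c2, z, v; unfold cross; simpl; ring. }
  destruct (circumcenter x1 y1 x2 y2 (cross p1 v)
              (Re (c2 * Cconj v)) (Im (c2 * Cconj v)) Hd Hk) as [Ecx Ecy].
  { unfold x1, y1; rewrite <- Hexp; now apply HCC. }
  { unfold x2, y2; rewrite <- Hexp; now apply HCC. }
  assert (Hcirc : forall z, circle c (Cmod c) z <->
            (normsq z * cross p1 v)%R = cross c2 (z * v)).
  { intros z; rewrite circle_through_0, Hexp.
    assert (Ere : Re c = (Im (c2 * Cconj v) / (2 * cross p1 v))%R).
    { rewrite <- Ecx; unfold c, d; simpl; ring. }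
    assert (Eim : Im c = (- Re (c2 * Cconj v) / (2 * cross p1 v))%R).
    { rewrite <- Ecy; unfold c, d; simpl; ring. }
    rewrite Ere, Eim; split; intros H.
    - rewrite H; field; exact Hk.
    - apply (Rmult_eq_reg_r (cross p1 v)); [rewrite H; field |]; exact Hk. }
  repeat split.
  - apply HL.
  - apply HL.
  - exact Hline0.
  - exact Hd.
  (* If [c = 0], the circle would shrink to the origin, yet it contains the nonzero point [w1]. *)
  - apply Cmod_gt_0; intros E.
    apply HCC in Hw1; destruct Hw1 as [Hw10 Hw1].
    apply Hcirc in Hw1; unfold circle in Hw1.
    rewrite E, Cmod_0 in Hw1; apply Cmod_eq_0 in Hw1.
    apply Hw10; rewrite <- Hw1; ring.
  - unfold circle.
    replace (0 - c) with (- c) by ring; apply Cmod_opp.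
  - now apply Hcirc, HCC.
  - now apply HCC.
  - intros [H1 H2]; apply HCC; split; [exact H2 | now apply Hcirc].
  - intros [H1 H2]; apply HL in H1; rewrite Er1, Er2.
    apply (line_meets_inverse p1 v z s Hk); split; [exact H1 |].
    rewrite <- Er1, <- Er2, <- Ec2; exact H2.
  - rewrite HL.
    rewrite Er1, Er2 in H.
    apply (line_meets_inverse p1 v z s Hk) in H.
    apply H.
  - rewrite Er1, Er2 in H.
    apply (line_meets_inverse p1 v z s Hk) in H.
    rewrite <- Er1, <- Er2, <- Ec2 in H; apply H.
Qed.
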